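(* Let $m\ge 4$ and $h\ge 0$, and let $(G,D)$ be a finite $3$-transposition group of type $3^{\bullet h}{:}2^{\bullet 1}{:}\operatorname{Sym}(m)$. Then the diagram of $(G,D)$ has size $n=3^{h}m(m-1)$ and spectrum $$((\,3^{h}(4m-7)-1;\ [3^h(2m-7)-1]^{m-1},\ [-3^{h+1}-1]^{m(m-3)/2},\ [3^h-1]^{m(m-1)/2},\ [-1]^{\star}\,)).$$
   Context: A $3$-transposition group $(G,D)$ is a group $G$ generated by a conjugacy class $D$ of elements of order $2$ such that $|de|\in\{1,2,3\}$ for all $d,e\in D$. Its diagram is the graph with vertex set $D$ in which $d$ and $e$ are adjacent iff $|de|=3$; its size is $n=|D|$. The spectrum is that of the $(0,1)$-adjacency matrix, written $((k;\dots,[r]^c,\dots))$: first the degree $k$ of the (regular) diagram, counted once, then the remaining eigenvalues, $[r]^c$ meaning $r$ with multiplicity $c$; if listed values coincide, their multiplicities are added, and $[r]^\star$ means that $r$ has whatever further multiplicity (possibly zero) is required for the total multiplicity to be $n$. For a prime $p\in\{2,3\}$ and a $3$-transposition group $(H,E)$, $(G,D)$ has type $p^{\bullet h}{:}H$ if $G$ has a normal $p$-subgroup $N$ with $|D\cap dN|=p^h$ for all $d\in D$ and $(G/N,DN/N)\cong(H,E)$. Type $3^{\bullet h}{:}2^{\bullet 1}{:}\operatorname{Sym}(m)$ means type $3^{\bullet h}{:}H$ with $(H,E)$ of type $2^{\bullet 1}{:}\operatorname{Sym}(m)$, where $\operatorname{Sym}(m)$ is taken with its class of transpositions. (The diagram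 depends only on these data; whether the extensions split plays no role.) *)

(* Defs.v *)
From HB Require Import structures.
From mathcomp Require Import all_boot all_order all_algebra all_fingroup.
From mathcomp Require Import all_solvable all_field.

Set Implicit Arguments.
Unset Strict Implicit.
Unset Printing Implicit Defensive.

Import GRing.Theory Num.Theory.

Local Open Scope group_scope.

Definition three_transposition_group (gT : finGroupType)
    (G : {group gT}) (D : {set gT}) : Prop :=
  [/\ D \in classes G,
      <<D>> = G :> {set gT},
      {in D, forall d, #[d] = 2} &
      {in D &, forall d e, #[d * e] \in [:: 1; 2; 3]%N}].

Definition pair_isog (aT rT : finGroupType) (G : {group aT}) (D : {set aT})
    (H : {group rT}) (E : {set rT}) : Prop :=
  exists2 f : {morphism G >-> rT}, isom G H f & f @* D = E.

(* Type p^(.h) : H; only used for p = 2 and p = 3. *)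
Definition has_type (p h : nat) (gT rT : finGroupType)
    (G : {group gT}) (D : {set gT}) (H : {group rT}) (E : {set rT}) : Prop :=
  exists N : {group gT},
    [/\ N <| G,
        p.-group N,
        {in D, forall d, #|D :&: (d *: N)| = (p ^ h)%N} &
        pair_isog (G / N)%G (D / N) H E].

Definition transpositions (m : nat) : {set 'S_m} :=
  [set s | [exists i, exists j, (i != j) && (s == tperm i j)]].

Definition has_type_3h_2_Sym (h m : nat) (gT : finGroupType)
    (G : {group gT}) (D : {set gT}) : Prop :=
  exists (rT : finGroupType) (H : {group rT}) (E : {set rT}),
    [/\ three_transposition_group H E,
        has_type 2 1 H E [set: 'S_m]%G (transpositions m) &
        has_type 3 h G D H E].

Definition diagram_adj (gT : finGroupType) : rel gT :=
  fun d e => #[d * e] == 3.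

Local Open Scope ring_scope.

Definition adjacency_matrix (gT : finGroupType) (D : {set gT}) :
    'M[algC]_#|D| :=
  \matrix_(i, j) (diagram_adj (enum_val i) (enum_val j))%:R.

(* The spectrum is ((k; s)): the diagram is regular of degree k, and k :: s
   lists the roots of the characteristic polynomial with multiplicity, so that
   size s + 1 = #|D| and s is determined up to permutation. *)
Definition has_spectrum (gT : finGroupType) (D : {set gT})
    (k : algC) (s : seq algC) : Prop :=
  {in D, forall d, #|[set e in D | diagram_adj d e]|%:R = k} /\
  char_poly (adjacency_matrix D) = \prod_(x <- k :: s) ('X - x%:P).

(* Main.v *)
Require Import Defs.
From HB Require Import structures.
From mathcomp Require Import all_boot all_order all_algebra all_fingroup.
From mathcomp Require Import all_solvable all_field.
From mathcomp Require Import zify ring.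

Set Implicit Arguments.
Unset Strict Implicit.
Unset Printing Implicit Defensive.

Import GRing.Theory Num.Theory.

Local Open Scope ring_scope.

(* The maps D -> E -> Sym(m) have fibers of constant size 3^h and 2.  Since the
   kernels are a 3-group and a 2-group and all orders are at most 3, elements
   in different fibers are adjacent iff their images are, whereas two elements
   of one fiber are adjacent in D but not in E.  Hence, with T the adjacency
   matrix of the transpositions, that of E is T (x) J_2 and that of D is
   ((T (x) J_2) + 1) (x) J_(3^h) - 1.  Finally T + 2 = B B^T for the incidence
   matrix B of transpositions against points, and B^T B = J_m + (m - 2).  All
   eigenvalues follow from the fact that A B and B A have the same
   characteristic polynomial up to a power of X. *)

(** * Characteristic polynomials of products, affine images and pullbacks *)

Lemma char_poly_mulmxC (R : comNzRingType) p q (A : 'M[R]_(p, q))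
    (B : 'M[R]_(q, p)) :
  'X ^+ q * char_poly (A *m B) = 'X ^+ p * char_poly (B *m A).
Proof.
rewrite /char_poly /char_poly_mx !map_mxM /=.
move: (map_mx _ A) (map_mx _ B) => {}A {}B; set x : {poly R} := 'X.
(* M becomes block triangular after multiplication by [1 0; -B 1] on the right
   and by [1 0; -B X] on the left. *)
pose M := block_mx x%:M A B 1%:M.
transitivity (x ^+ q * \det M).
  congr (_ * _); have := det_mulmx M (block_mx 1%:M 0 (- B) 1%:M).
  rewrite det_lblock !det1 !mulr1 => <-.
  rewrite mulmx_block !mulmx0 !mulmx1 !mul1mx mulmxN subrr !add0r.
  by rewrite det_ublock det1 mulr1.
have := det_mulmx (block_mx 1%:M 0 (- B) x%:M) M.
rewrite det_lblock det1 mul1r det_scalar => <-.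
rewrite mulmx_block !mul0mx !mul1mx mulNmx !addr0 !mulmx1.
rewrite mul_mx_scalar mul_scalar_mx addNr det_ublock det_scalar.
by rewrite mulNmx addrC.
Qed.

Section CharPolyRoots.

Variable F : fieldType.
Implicit Types (s : seq F) (a b : F).

Lemma size_char_poly_roots n (A : 'M[F]_n) s :
  char_poly A = \prod_(x <- s) ('X - x%:P) -> size s = n.
Proof.
move=> /(congr1 (fun p : {poly F} => size p)).
by rewrite size_char_poly size_prod_XsubC => -[].
Qed.

(** The new characteristic polynomial is [a ^ n] times that of [A] evaluated at [(X - b) / a]; each
    of the [n] linear factors absorbs one [a]. *)
Lemma char_poly_affine_roots n (A : 'M[F]_n) s a b : a != 0 ->
  char_poly A = \prod_(x <- s) ('X - x%:P) ->
  char_poly (a *: A + b%:M) =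
    \prod_(x <- [seq a * x + b | x <- s]) ('X - x%:P).
Proof.
move=> a0 As; have sz := size_char_poly_roots As.
have aK (q : {poly F}) : a%:P * ((a^-1)%:P * q) = q.
  by rewrite mulrA -polyCM mulfV // mul1r.
pose q : {poly F} := (a^-1)%:P * ('X - b%:P).
have -> : char_poly (a *: A + b%:M) = a%:P ^+ n * (char_poly A \Po q).
  rewrite /char_poly -(det_map_mx (comp_poly q)) -detZ; congr (\det _).
  apply/matrixP=> i j; rewrite !mxE rmorphB rmorphMn /= comp_polyX comp_polyC.
  rewrite mulrBr mulrnAr aK polyCD polyCM polyCMn; case: eqP => _.
    by rewrite !mulr1n opprD addrAC addrA addrAC.
  by rewrite !mulr0n addr0 !sub0r.
rewrite As rmorph_prod /= -sz big_map {As sz}.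
elim: s => [|x s IHs]; first by rewrite !big_nil mulr1.
rewrite !big_cons -IHs /= exprS mulrACA; congr (_ * _).
rewrite rmorphB /= comp_polyX comp_polyC mulrBr aK polyCD polyCM opprD.
by rewrite addrAC -addrA.
Qed.

(** Cancelling [X ^ q] in [char_poly_mulmxC] leaves [p - q] extra zero roots. *)
Lemma char_poly_mulmx_roots p q (A : 'M[F]_(p, q)) (B : 'M[F]_(q, p)) s :
    (q <= p)%N -> char_poly (B *m A) = \prod_(x <- s) ('X - x%:P) ->
  char_poly (A *m B) = \prod_(x <- s ++ nseq (p - q) 0) ('X - x%:P).
Proof.
move=> leqp BAs; have Xq0: 'X ^+ q != 0 :> {poly F} by rewrite monic_neq0 ?monicXn.
apply: (mulfI Xq0); rewrite char_poly_mulmxC BAs big_cat big_nseq subr0 /=.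
by rewrite iter_mulr_1 mulrCA -exprD subnKC // mulrC.
Qed.

Definition set_mx (T : finType) (D : {set T}) (f : T -> T -> F) : 'M[F]_#|D| :=
  \matrix_(i, j) f (enum_val i) (enum_val j).

Lemma card_fibers (T S : finType) (D : {set T}) (E : {set S}) (g : T -> S) c :
    {in D, forall x, g x \in E} ->
    {in E, forall y, #|[set x in D | g x == y]| = c} ->
  #|D| = (c * #|E|)%N.
Proof.
move=> gD gc; rewrite -sum1_card (partition_big g (mem E)) //=.
rewrite mulnC -sum_nat_const; apply: eq_bigr => y /gc <-.
by rewrite -sum1_card; apply: eq_bigl => x; rewrite inE.
Qed.

(* With [K] the incidence matrix of the fibers of [g], the matrix on [D] is
   [K M K^T], where [M] is the matrix on [E] and [K^T K = c]. *)
Lemma char_poly_pullback_roots (T S : finType) (D : {set T}) (E : {set S})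
    (g : T -> S) c (f : S -> S -> F) s :
    {in D, forall x, g x \in E} ->
    {in E, forall y, #|[set x in D | g x == y]| = c} ->
    c%:R != 0 :> F ->
    char_poly (set_mx E f) = \prod_(x <- s) ('X - x%:P) ->
  char_poly (set_mx D (fun x y => f (g x) (g y))) =
    \prod_(x <- [seq c%:R * x | x <- s] ++ nseq (#|D| - #|E|) 0) ('X - x%:P).
Proof.
move=> gD gc c0 Es.
pose K : 'M[F]_(#|D|, #|E|) := \matrix_(i, j) (g (enum_val i) == enum_val j)%:R.
(* Each row of [K] has a single 1, so multiplying by [K] on the left is composition with [g]. *)
have KF (h : S -> F) i : \sum_j K i j * h (enum_val j) = h (g (enum_val i)).
  have gi := gD _ (enum_valP i).
  rewrite (bigD1 (enum_rank_in gi (g (enum_val i)))) //= !mxE enum_rankK_in //.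
  rewrite eqxx mul1r big1 ?addr0 // => j ne.
  rewrite mxE; case: eqP => [e|]; last by rewrite mul0r.
  by case/eqP: ne; apply: enum_val_inj; rewrite enum_rankK_in.
have -> : set_mx D (fun x y => f (g x) (g y)) = K *m (set_mx E f *m K^T).
  have MKE k j : (set_mx E f *m K^T) k j = f (enum_val k) (g (enum_val j)).
    rewrite -(KF (f (enum_val k))) mxE.
    by apply: eq_bigr => l _; rewrite !mxE mulrC.
  apply/matrixP=> i j; rewrite mxE [RHS]mxE.
  rewrite -(KF (fun y => f y (g (enum_val j)))).
  by apply: eq_bigr => k _; rewrite MKE.
apply: char_poly_mulmx_roots.
  by rewrite (card_fibers gD gc) leq_pmull // lt0n; apply: contraNneq c0 => ->.
(* Distinct fibers are disjoint and each has [c] elements. *)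
have KK : K^T *m K = (c%:R)%:M.
  apply/matrixP=> i j; rewrite !mxE.
  under eq_bigr => k _ do rewrite !mxE -natrM mulnb.
  rewrite -natr_sum.
  rewrite -(big_enum_val
    (fun x => (g x == enum_val i) && (g x == enum_val j) : nat)) /=.
  case: (eqVneq i j) => [<-|ij].
    rewrite -(gc _ (enum_valP i)) mulr1n -sum1_card big_mkcond /=.
    rewrite [in RHS]big_mkcond /=; congr (_%:R); apply: eq_bigr => x _.
    by rewrite inE andbb; case: (x \in D); case: eqP.
  rewrite big1 // => x _; case: eqP => //= ->; case: eqP => // /enum_val_inj ij'.
  by rewrite ij' eqxx in ij.
rewrite -mulmxA KK mul_mx_scalar -[c%:R *: _]addr0 -(raddf0 (@scalar_mx _ #|E|)).
rewrite (char_poly_affine_roots 0 c0 Es); congr (\prod_(x <- _) _).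
by apply: eq_map => x; rewrite addr0.
Qed.

End CharPolyRoots.

(** * Morphisms attached to types, and adjacency along them *)

(** [g] is the quotient by [N] followed by the isomorphism: its kernel lies in [N], and its fibers
    in [D] are the sets [D :&: (d *: N)]. *)
Lemma has_type_morphism p h (gT rT : finGroupType) (G : {group gT})
    (D : {set gT}) (H : {group rT}) (E : {set rT}) :
    D \subset G -> has_type p h G D H E ->
  exists g : {morphism G >-> rT},
    [/\ {in D, forall d, g d \in E},
        {in E, forall e, #|[set d in D | g d == e]| = (p ^ h)%N} &
        {in G, forall x, g x = 1%g -> p.-elt%g x}].
Proof.
move=> sDG [N [nNG pN cN [f /isomP[injf _] <-]]].
have nNx x : x \in G -> x \in 'N(N)%g by move/(subsetP (normal_norm nNG)).
have GNx x : x \in G -> coset N x \in (G / N)%g by exact: mem_quotient.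
have gM : {in G &, {morph (fun x => f (coset N x)) : x y / (x * y)%g}}.
  by move=> x y Gx Gy; rewrite /= morphM ?nNx // morphM ?GNx.
exists (Morphism gM); split=> /=.
- move=> d Dd; have Gd := subsetP sDG _ Dd.
  by apply: mem_morphim; [exact: GNx | apply: mem_morphim (nNx _ Gd) Dd].
- move=> _ /morphimP[_ _ /morphimP[d _ Dd ->] ->]; rewrite -(cN d Dd).
  have Gd := subsetP sDG _ Dd; apply: eq_card => x.
  rewrite !inE mem_lcoset; case Dx: (x \in D) => //=.
  have Gx := subsetP sDG _ Dx.
  rewrite (inj_in_eq (injmP injf)) ?GNx // eq_sym eq_mulVg1.
  rewrite -morphV ?nNx // -morphM ?groupV ?nNx //.
  apply/eqP/idP=> [/coset_idr|/coset_id//]; apply.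
  by rewrite groupM ?groupV ?nNx.
- move=> x Gx fx1; apply: mem_p_elt pN _; apply: coset_idr; first exact: nNx.
  by apply: (injmP injf); rewrite ?GNx ?group1 ?morph1.
Qed.

Section MorphismOrder.

Variables (gT rT : finGroupType) (G : {group gT}) (D : {set gT}).
Variable g : {morphism G >-> rT}.

(** The order of [g x] divides that of [x], which is 1 or a prime, so a nontrivial image has the
    same order. *)
Lemma morph_order_eq3 x : x \in G -> #[x]%g \in [:: 1; 2; 3]%N ->
  g x != 1%g -> (#[g x]%g == 3%N) = (#[x]%g == 3%N).
Proof.
move=> Gx xo; rewrite -order_eq1; have := morph_order g Gx.
move: (#[g x]%g) (#[x]%g) xo => a b; rewrite !inE.
by case/or3P=> /eqP-> ab; have /(_ isT) := dvdn_leq _ ab;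
  move: ab; case: a => [|[|[|[|a]]]].
Qed.

Hypothesis GD : three_transposition_group G D.

Lemma three_transposition_subset : D \subset G.
Proof. by case: GD => _ <- _ _; apply: subset_gen. Qed.

Let sDG := subsetP three_transposition_subset.

(** When [g (x * y)] is trivial, [x * y] is a 2-element, so neither pair is adjacent; otherwise
    [morph_order_eq3] applies. *)
Lemma diagram_adj_morph2 : {in G, forall x, g x = 1%g -> 2.-elt%g x} ->
  {in D &, forall x y, diagram_adj x y = diagram_adj (g x) (g y)}.
Proof.
case: (GD) => _ _ _ Do g2 x y Dx Dy; have [Gx Gy] := (sDG Dx, sDG Dy).
rewrite /diagram_adj -morphM //; have [g1|] := eqVneq (g (x * y)%g) 1%g.
  rewrite g1 order1; have := g2 _ (groupM Gx Gy) g1; rewrite /p_elt.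
  by apply: contraTF => /eqP->.
by move=> g1; rewrite morph_order_eq3 ?groupM ?Do.
Qed.

(** Distinct elements of one fiber have a nontrivial 3-element as product, so they are adjacent
    while their images coincide; allowing equality on both sides makes the relation pull back
    exactly. *)
Lemma diagram_adj_morph3 : {in G, forall x, g x = 1%g -> 3.-elt%g x} ->
  {in D &, forall x y, diagram_adj x y || (x == y) =
    diagram_adj (g x) (g y) || (g x == g y)}.
Proof.
case: (GD) => _ _ D2 Do g3 x y Dx Dy; have [Gx Gy] := (sDG Dx, sDG Dy).
have [->|xy] := eqVneq x y; first by rewrite eqxx !orbT.
(* Since [y] is its own inverse, triviality of [x * y] tests equality, and likewise for the
   images. *)
have yV : (y^-1 = y)%g by apply/eqP; rewrite eq_invg_mul -expg2 -(D2 y Dy) expg_order.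
have gxy : (g x == g y) = (g (x * y)%g == 1%g).
  by rewrite eq_mulgV1 -morphV // yV morphM.
rewrite /diagram_adj gxy -morphM // orbF; have [g1|g1] := eqVneq (g (x * y)%g) 1%g.
  have xy1 : (x * y != 1)%g by rewrite -{1}yV -eq_mulgV1.
  have := Do x y Dx Dy; have := g3 _ (groupM Gx Gy) g1.
  rewrite /p_elt !inE order_eq1 (negbTE xy1) orbT /= => o3 /orP[]// /eqP o2.
  by rewrite o2 in o3.
by rewrite orbF morph_order_eq3 ?groupM ?Do.
Qed.

End MorphismOrder.

(** * Transpositions and the points they move *)

Section Transpositions.

Variable m : nat.
Implicit Types (i j k l : 'I_m) (s t : 'S_m).

Lemma transpositionP s :
  reflect (exists i j, i != j /\ s = tperm i j) (s \in transpositions m).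
Proof.
rewrite inE; apply: (iffP existsP) => [[i /existsP[j /andP[ij /eqP->]]]|].
  by exists i, j.
by move=> [i [j [ij ->]]]; exists i; apply/existsP; exists j; rewrite ij eqxx.
Qed.

Lemma tperm_moves i j k : i != j -> (tperm i j k != k) = (k \in [set i; j]).
Proof.
rewrite !inE; case: tpermP => [->|->|/eqP/negbTE-> /eqP/negbTE->].
- by rewrite eqxx eq_sym.
- by rewrite eqxx orbT.
- by rewrite eqxx.
Qed.

(** Each transposition conjugates the other to [tperm j l]; this gives the braid relation, which
    makes the cube of the product trivial. *)
Lemma order_mul_tperm3 i j l : i != j -> i != l -> j != l ->
  #[tperm i j * tperm i l]%g = 3%N.
Proof.
move=> ij il jl.
have tsE : (tperm i l ^ tperm i j = tperm j l)%g.
  by rewrite tpermJ tpermL tpermD // eq_sym.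
have stE : (tperm i j ^ tperm i l = tperm j l)%g.
  by rewrite tpermJ tpermL tpermD 1?tpermC // eq_sym.
move: tsE; rewrite -{}stE !conjgE !tpermV => braid.
apply: nt_prime_order => //.
  rewrite !expgS expg0 mulg1 -!mulgA -braid (mulgA (tperm i j) (tperm i j)).
  by rewrite tperm2 mul1g (mulgA (tperm i l) (tperm i l)) tperm2 mul1g tperm2.
apply/eqP=> /permP/(_ i); rewrite permM tpermL perm1 tpermD // 1?eq_sym // => ji.
by rewrite ji eqxx in ij.
Qed.

Lemma order_mul_disjoint_tperm i j k l :
    i \notin [set k; l] -> j \notin [set k; l] ->
  (#[tperm i j * tperm k l]%g %| 2)%N.
Proof.
rewrite !inE !negb_or ![_ == k]eq_sym ![_ == l]eq_sym.
move=> /andP[ki li] /andP[kj lj]; rewrite order_dvdn.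
have c : commute (tperm i j) (tperm k l).
  by apply/commgP/conjg_fixP; rewrite tpermJ !tpermD.
by rewrite expgMn // !expg2 !tperm2 mulg1.
Qed.

(** Its size is the entry of [B B^T] at [s] and [t]. *)
Definition moved2 s t : {set 'I_m} := [set i | (s i != i) && (t i != i)].

(** This is [B B^T = T + 2] entrywise: two transpositions share two points, one point or none
    according as they are equal, adjacent or neither. *)
Lemma card_moved2 s t : s \in transpositions m -> t \in transpositions m ->
  #|moved2 s t| = (diagram_adj s t + 2 * (s == t))%N.
Proof.
(* The common point is in first position here; its other positions reduce to this one by
   [tpermC]. *)
have meet i j l : i != j -> i != l ->
  #|moved2 (tperm i j) (tperm i l)| =
    (diagram_adj (tperm i j) (tperm i l) + 2 * (tperm i j == tperm i l))%N.
  move=> ij il; have [<-|jl] := eqVneq j l.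
    rewrite eqxx /diagram_adj tperm2 order1 add0n muln1.
    have /= := cards2 i j; rewrite ij => <-; apply: eq_card => x.
    by rewrite inE andbb tperm_moves.
  rewrite /diagram_adj order_mul_tperm3 // eqxx.
  have -> : (tperm i j == tperm i l) = false.
    by apply/eqP=> /permP/(_ i); rewrite !tpermL; apply/eqP.
  transitivity #|[set i]|; last by rewrite cards1.
  apply: eq_card => x; rewrite inE !tperm_moves // !inE.
  case: (eqVneq x i) => //= _; case: eqP => // ->; exact: negbTE.
move=> /transpositionP[i [j [ij ->]]] /transpositionP[k [l [kl ->]]].
have [|ikl] := boolP (i \in [set k; l]).
  rewrite !inE => /orP[] /eqP ik; rewrite -ik in kl *; first exact: meet.
  by rewrite (tpermC k); apply: meet; rewrite // eq_sym.
have [|jkl] := boolP (j \in [set k; l]).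
  rewrite (tpermC i); rewrite !inE => /orP[] /eqP jk; rewrite -jk in kl *.
    by apply: meet; rewrite // eq_sym.
  by rewrite (tpermC k); apply: meet; rewrite // eq_sym.
have := order_mul_disjoint_tperm ikl jkl.
rewrite /diagram_adj; case: eqP => [->//|_ _].
have disj x : (x \in [set i; j]) && (x \in [set k; l]) = false.
  rewrite [x \in [set i; j]]inE !in_set1.
  by case: (eqVneq x i) => [->|_];
    [apply: negbTE | case: (eqVneq x j) => [->|]; [apply: negbTE|]].
have -> : (tperm i j == tperm k l) = false.
  apply/eqP=> e; have := disj i; rewrite -!tperm_moves // -e tpermL eq_sym ij.
  by [].
by apply: eq_card0 => x; rewrite inE !tperm_moves.
Qed.

(** These are the entries of [B^T B]: a transposition moving [i] is [tperm i x] for a unique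
    [x != i]. *)
Lemma card_transpositions_moving2 i j :
  #|[set t in transpositions m | (t i != i) && (t j != j)]| =
    (if i == j then m.-1 else 1)%N.
Proof.
case: eqVneq => [<-|ij].
  rewrite -[in RHS](card_ord m) -(cardsC1 i).
  have /card_in_imset <- : {in [set~ i] &, injective (tperm i)}.
    by move=> x y _ _ /permP/(_ i); rewrite !tpermL.
  apply: eq_card => t; rewrite !inE andbb; apply/andP/imsetP.
    case=> /existsP[k /existsP[l /andP[kl /eqP->]]].
    rewrite tperm_moves // !inE => /orP[] /eqP->; last rewrite tpermC.
      by exists l; rewrite // !inE eq_sym.
    by exists k; rewrite // !inE.
  case=> x; rewrite !inE eq_sym => ix ->; split.
    by apply/existsP; exists i; apply/existsP; exists x; rewrite ix eqxx.
  by rewrite tpermL eq_sym.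
rewrite -(cards1 (tperm i j)); apply: eq_card => t; rewrite [in RHS]inE.
rewrite inE; apply/andP/eqP.
  case=> /transpositionP[k [l [kl ->]]]; rewrite !tperm_moves // !inE.
  case/andP=> /orP[] /eqP ik /orP[] /eqP jk; rewrite ik jk in ij *;
    rewrite ?eqxx // in ij; exact: tpermC.
move=> ->; rewrite tpermL tpermR eq_sym ij; split=> //.
by apply/transpositionP; exists i, j.
Qed.

(** Double counting: every point moved by [s] is moved by [m.-1] transpositions. *)
Lemma sum_card_moved2 s :
  (\sum_(t in transpositions m) #|moved2 s t| =
     m.-1 * #|[set i | s i != i]|)%N.
Proof.
under eq_bigr => t _ do rewrite -sum1_card big_mkcond.
rewrite exchange_big mulnC -sum_nat_const [RHS]big_mkcond /=.
apply: eq_bigr => i _; rewrite inE; case: ifP => si; last first.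
  by apply: big1 => t _; rewrite inE si.
have := card_transpositions_moving2 i i; rewrite eqxx => <-.
rewrite -sum1_card [LHS]big_mkcond [RHS]big_mkcond; apply: eq_bigr => t _.
by rewrite /moved2 ![in RHS]inE andbb !inE si /=; case: ifP.
Qed.

Lemma card_transpositions : (2 * #|transpositions m| = m * m.-1)%N.
Proof.
rewrite mulnC -sum_nat_const.
have -> : (\sum_(t in transpositions m) 2 =
    \sum_(t in transpositions m) \sum_(i | t i != i) 1)%N.
  apply: eq_bigr => t Tt; have := card_moved2 Tt Tt.
  rewrite eqxx /diagram_adj sum1_card.
  have -> : (t * t = 1)%g by case/transpositionP: Tt => i [j [_ ->]]; rewrite tperm2.
  rewrite order1 add0n muln1 => <-; apply: eq_card => i.
  by rewrite inE andbb.
rewrite (exchange_big_dep xpredT) //= -[X in (X * _)%N](card_ord m) -sum_nat_const.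
apply: eq_bigr => i _; have := card_transpositions_moving2 i i; rewrite eqxx => <-.
by rewrite sum1_card; apply: eq_card => t; rewrite [RHS]inE andbb.
Qed.

(** Both [card_moved2] and [sum_card_moved2] evaluate the same sum; the 2 on the left comes from the
    term [t = s]. *)
Lemma card_transposition_neighbours s : s \in transpositions m ->
  (#|[set t in transpositions m | diagram_adj s t]| + 2 = 2 * m.-1)%N.
Proof.
move=> Ts; have := sum_card_moved2 s.
have -> : #|[set i | s i != i]| = 2%N.
  case/transpositionP: Ts => i [j [ij ->]].
  transitivity #|[set i; j]|; last by rewrite cards2 ij.
  by apply: eq_card => x; rewrite inE tperm_moves.
rewrite mulnC => <-.
rewrite (eq_bigr (fun t => diagram_adj s t + 2 * (s == t))%N); last first.
  by move=> t Tt; rewrite card_moved2.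
rewrite big_split /=; congr (_ + _)%N.
  rewrite -sum1_card [LHS]big_mkcond [RHS]big_mkcond /=; apply: eq_bigr => t _.
  by rewrite inE; case: (t \in _) => //; case: diagram_adj.
rewrite (bigD1 s) //= eqxx big1 // => t /andP[_ ts].
by rewrite eq_sym (negbTE ts).
Qed.

End Transpositions.

(** * The spectrum of the diagram of transpositions *)

Lemma sum_nat_of_bool (T : finType) (P : pred T) (D : {pred T}) :
  (\sum_(x in D) P x)%N = #|[set x in D | P x]|.
Proof.
rewrite -sum1_card [LHS]big_mkcond [RHS]big_mkcond /=; apply: eq_bigr => x _.
by rewrite inE; case: (x \in D); case: (P x).
Qed.

Definition adj_mx (F : fieldType) (gT : finGroupType) (D : {set gT}) :=
  set_mx D (fun d e => (diagram_adj d e)%:R : F).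

(** Roots are carried from the all-ones matrix to [B^T B] by a shift of [m - 2], to [B B^T] by
    adding zeros, and to the adjacency matrix by a shift of [- 2]. *)
Lemma char_poly_adj_transpositions (F : fieldType) m : (2 < m)%N ->
  char_poly (adj_mx F (transpositions m)) =
    \prod_(x <- (2 * m%:R - 4) :: nseq (m - 1) (m%:R - 4)
                  ++ nseq (#|transpositions m| - m) (- 2)) ('X - x%:P).
Proof.
move=> m3; pose T := transpositions m.
pose B : 'M[F]_(#|T|, m) := \matrix_(k, i) ((enum_val k : 'S_m) i != i)%:R.
(* This is where [2 < m] matters: [m * (m - 1) / 2] has to reach [m]. *)
have leT : (m <= #|T|)%N by have := card_transpositions m; rewrite -/T; nia.
have BBt : B *m B^T + (- 2)%:M = adj_mx F T.
  apply/matrixP=> k l; rewrite !mxE.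
  under eq_bigr => i _ do rewrite !mxE -natrM mulnb.
  rewrite -natr_sum (sum_nat_of_bool _ predT) /=.
  rewrite (_ : #|_| = #|moved2 (enum_val k) (enum_val l)|); last first.
    by apply: eq_card => i; rewrite !inE.
  rewrite card_moved2 ?enum_valP // (inj_eq enum_val_inj) natrD natrM.
  by case: (k == l); rewrite ?mulr1n ?mulr0n; ring.
(* The all-ones matrix is written as a column times a row, so that its roots come from a 1 by 1
   matrix. *)
have BtB : B^T *m B = 1 *: (const_mx 1 *m (const_mx 1 : 'rV_m)) + (m%:R - 2)%:M.
  apply/matrixP=> i j; rewrite !mxE big_ord1 !mxE.
  under eq_bigr => k _ do rewrite !mxE -natrM mulnb.
  rewrite -natr_sum.
  rewrite -(big_enum_val (fun t : 'S_m => (t i != i) && (t j != j) : nat)) /=.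
  rewrite sum_nat_of_bool card_transpositions_moving2 -subn1; case: eqP => _ /=.
    by rewrite natrB ?(ltnW (ltnW m3)) // mulr1n; ring.
  by rewrite mulr0n; ring.
have J1 : char_poly ((const_mx 1 : 'rV_m) *m const_mx 1 : 'M[F]_1) =
    \prod_(x <- [:: m%:R]) ('X - x%:P).
  rewrite big_seq1 /char_poly det_mx11 !mxE mulr1n; congr (_ - _%:P).
  under eq_bigr => i _ do rewrite !mxE mulr1.
  by rewrite sumr_const card_ord.
have J := char_poly_mulmx_roots (ltnW (ltnW m3)) J1.
have {}J := char_poly_affine_roots (m%:R - 2) (oner_neq0 F) J.
rewrite -BtB in J; have {}J := char_poly_mulmx_roots leT J.
have {}J := char_poly_affine_roots (- 2) (oner_neq0 F) J.
rewrite scale1r BBt in J; rewrite J; congr (\prod_(x <- _) _).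
rewrite /= map_cat !map_nseq /=.
congr [:: _ & nseq _ _ ++ nseq _ _]; ring.
Qed.

(** * From transpositions to [E] and [D] *)

Lemma eq_set_mx (F : fieldType) (T : finType) (D : {set T}) (f f' : T -> T -> F) :
  {in D &, f =2 f'} -> set_mx D f = set_mx D f'.
Proof. by move=> ff'; apply/matrixP=> i j; rewrite !mxE ff' ?enum_valP. Qed.

Lemma card_fibers_restrict (T S : finType) (D : {set T}) (E : {set S})
    (g : T -> S) c (P : pred S) :
    {in D, forall x, g x \in E} ->
    {in E, forall y, #|[set x in D | g x == y]| = c} ->
  #|[set x in D | P (g x)]| = (c * #|[set y in E | P y]|)%N.
Proof.
move=> gD gc; apply: (@card_fibers _ _ _ _ g) => [x | y]; rewrite !inE.
  by case/andP=> /gD -> ->.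
case/andP=> /gc <- Py; apply: eq_card => x; rewrite !inE.
by case: eqP => [->|]; rewrite ?Py ?andbT ?andbF.
Qed.

Lemma diagram_adj_involution (gT : finGroupType) (x : gT) :
  #[x]%g = 2%N -> diagram_adj x x = false.
Proof.
move=> x2; have xx : (x * x)%g = 1%g by rewrite -expg2 -x2 expg_order.
by rewrite /diagram_adj xx order1.
Qed.

Lemma card_closed_neighbours (gT : finGroupType) (x : gT) (D : {set gT}) :
    #[x]%g = 2%N -> x \in D ->
  #|[set y in D | diagram_adj x y || (x == y)]| =
    #|[set y in D | diagram_adj x y]|.+1.
Proof.
move=> x2 Dx; rewrite (cardsD1 x) !inE Dx eqxx orbT; congr (_.+1).
apply: eq_card => y; rewrite !inE eq_sym.
by case: eqP => [<-|_]; rewrite ?orbF ?diagram_adj_involution ?andbF.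
Qed.

(** Adding 1 produces closed adjacency, the relation that [diagram_adj_morph3] pulls back. *)
Lemma adj_mxD1 (F : fieldType) (gT : finGroupType) (D : {set gT}) :
    {in D, forall d, #[d]%g = 2%N} ->
  adj_mx F D + 1%:M = set_mx D (fun d e => (diagram_adj d e || (d == e))%:R).
Proof.
move=> D2; apply/matrixP=> i j; rewrite !mxE (inj_eq enum_val_inj).
case: (eqVneq i j) => [->|_]; last by rewrite orbF addr0.
by rewrite diagram_adj_involution ?D2 ?enum_valP // add0r.
Qed.

Theorem proposition6p5 (m h : nat) (gT : finGroupType)
    (G : {group gT}) (D : {set gT})
    (hm : (4 <= m)%N)
    (hGD : three_transposition_group G D)
    (htype : has_type_3h_2_Sym h m G D) :
  #|D| = (3 ^ h * (m * (m - 1)))%N /\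
  exists c : nat,
    has_spectrum D
      (3 ^+ h * (4 * m%:R - 7) - 1)
      (nseq (m - 1) (3 ^+ h * (2 * m%:R - 7) - 1)
       ++ nseq ((m * (m - 3)) %/ 2) (- 3 ^+ h.+1 - 1)
       ++ nseq ((m * (m - 1)) %/ 2) (3 ^+ h - 1)
       ++ nseq c (- 1)).
Proof.
case: htype => rT [H [E [hHE typeE typeD]]].
have [g [gDE gc g3]] := has_type_morphism (three_transposition_subset hGD) typeD.
have [f [fET fc f2]] := has_type_morphism (three_transposition_subset hHE) typeE.
rewrite expn1 in fc.
have cT := card_transpositions m.
have cE : #|E| = (m * (m - 1))%N by rewrite (card_fibers fET fc) cT subn1.
have cD : #|D| = (3 ^ h * (m * (m - 1)))%N by rewrite (card_fibers gDE gc) cE.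
(* The zeros added by the pullback to [D] end up as the unspecified multiplicity of [- 1]. *)
split=> //; exists (#|D| - #|E|)%N; split.
  move=> d Dd.
  have degT := card_transposition_neighbours (fET _ (gDE _ Dd)).
  have degE : #|[set e in E | diagram_adj (g d) e]| = (4 * m - 8)%N.
    transitivity #|[set e in E | diagram_adj (f (g d)) (f e)]|.
      apply: eq_card => e; rewrite !inE; case Ee: (e \in E) => //=.
      by rewrite (diagram_adj_morph2 hHE f2) ?gDE.
    (* The transposition has [2 * m - 4] neighbours, each with two preimages in [E]. *)
    rewrite (card_fibers_restrict (diagram_adj (f (g d))) fET fc).
    by move: degT; move: #|_| => n; lia.
  have d2 : #[d]%g = 2%N by case: hGD => _ _ ->.
  have gd2 : #[g d]%g = 2%N by case: hHE => _ _ ->; rewrite ?gDE.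
  have := card_closed_neighbours d2 Dd.
  have -> : #|[set y in D | diagram_adj d y || (d == y)]| =
      #|[set y in D | diagram_adj (g d) (g y) || (g d == g y)]|.
    apply: eq_card => e; rewrite !inE; case De: (e \in D) => //=.
    by rewrite (diagram_adj_morph3 hGD g3).
  rewrite (card_fibers_restrict (fun y => diagram_adj (g d) y || (g d == y)) gDE gc).
  rewrite card_closed_neighbours ?gDE // degE => /(congr1 (fun n => n%:R : algC)).
  have -> : (4 * m - 8).+1 = (4 * m - 7)%N by lia.
  rewrite natrM natrX -addn1 natrD natrB; last by lia.
  by rewrite natrM => ->; ring.
have two0 : 2%:R != 0 :> algC by rewrite pnatr_eq0.
have three0 : (3 ^ h)%N%:R != 0 :> algC by rewrite pnatr_eq0 expn_eq0.
have sT := char_poly_adj_transpositions algC (ltnW hm).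
(* Pulling back to [E] doubles the roots and adds [#|E| - #|transpositions m|] zeros. *)
have {sT} := char_poly_pullback_roots fET fc two0 sT.
rewrite -(@eq_set_mx _ _ E (fun d e => (diagram_adj d e)%:R)); last first.
  by move=> x y Ex Ey /=; rewrite (diagram_adj_morph2 hHE f2).
(* After this shift to closed adjacency the zeros just added become 1, and finally [3 ^ h - 1]. *)
move=> /(char_poly_affine_roots 1 (oner_neq0 algC)).
rewrite scale1r -/(adj_mx algC E) adj_mxD1; last by case: hHE.
move=> sE; have {sE} := char_poly_pullback_roots gDE gc three0 sE.
rewrite -(@eq_set_mx _ _ D (fun d e => (diagram_adj d e || (d == e))%:R)); last first.
  by move=> x y Dx Dy /=; rewrite (diagram_adj_morph3 hGD g3).
(* Subtracting 1 returns from closed adjacency to adjacency on [D]. *)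
move=> /(char_poly_affine_roots (- 1) (oner_neq0 algC)).
rewrite scale1r -adj_mxD1; last by case: hGD.
rewrite -addrA -raddfD subrr raddf0 addr0.
move=> ->; congr (\prod_(x <- _) _).
(* The two multiplicities are [m(m - 1)/2 - m] and, since [E] is twice as large as the set of
   transpositions, [m(m - 1)/2]. *)
have -> : ((m * (m - 3)) %/ 2)%N = (#|transpositions m| - m)%N.
  rewrite -[RHS](mulKn _ (isT : (0 < 2)%N)) [in RHS]mulnBr cT -subn1.
  by congr (_ %/ 2)%N; nia.
have -> : ((m * (m - 1)) %/ 2)%N = (#|E| - #|transpositions m|)%N.
  by rewrite cE subn1 -cT mulKn // mul2n -addnn addnK.
rewrite /= !map_cat !map_nseq /= -!catA natrX exprS.
congr [:: _ & nseq _ _ ++ nseq _ _ ++ nseq _ _ ++ nseq _ _]; ring.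
Qed.
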